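(* Let $X$ be a Banach space and $T:X\rightrightarrows X^*$ a regular maximal monotone multifunction. For $\varepsilon\geq 0$ and $x\in X$ let $$T_\varepsilon(x)=\{x^*\in X^*: \langle x^*-y^*,x-y\rangle\ge-\varepsilon\ \text{ for all }(y,y^* )\in G(T)\}.$$ If $\varepsilon>0$ and $T_\varepsilon(x)\neq\emptyset$, then $x\in\overline{D_T}$; that is, $D_{T_\varepsilon}\subseteq\overline{D_T}$.
   Context: $X$ is a (real) Banach space with topological dual $X^*$ and $\langle x^*,x\rangle=\langle x,x^*\rangle$ denotes the evaluation pairing. For a multifunction $T:X\rightrightarrows X^*$, its graph is $G(T)=\{(x,x^* )\in X\times X^*: x^*\in T(x)\}$ and its domain is $D_T=\{x\in X: T(x)\neq\emptyset\}$; likewise $D_{T_\varepsilon}=\{x\in X: T_\varepsilon(x)\neq\emptyset\}$. $\overline{D_T}$ is the norm closure of $D_T$. $T$ is monotone if $\langle x^*-y^*,x-y\rangle\ge 0$ for all $(x,x^* ),(y,y^* )\in G(T)$; it is maximal monotone if it is monotone and there is no monotone multifunction $S:X\rightrightarrows X^*$ whose graph strictly contains $G(T)$. For $(x,x^* )\in X\times X^*$ put $$L(x,x^*,T)=\max\left\{0,\ \sup\left\{\frac{\langle x^*-y^*,y-x\rangle}{\|x-y\|}: (y,y^* )\in G(T),\ y\neq x\right\}\right\}\in[0,\infty],$$ and $d(x^*,T(x))=\inf\{\|y^*-x^*\|: y^*\in T(x)\}$, with $d(x^*,\emptyset)=\infty$. A maximal monotone multifunction $T$ is called regular if $L(x,x^*,T)=d(x^*,T(x))$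 for every $(x,x^* )\in X\times X^*$. *)

(* Defs.v *)
From HB Require Import structures.
From mathcomp Require Import all_boot all_order all_algebra.
From mathcomp Require Import all_classical all_reals all_analysis.
Set Implicit Arguments.
Unset Strict Implicit.
Unset Printing Implicit Defensive.
Import Order.TTheory GRing.Theory Num.Theory.
Import numFieldNormedType.Exports.
Local Open Scope classical_set_scope.
Local Open Scope ring_scope.

Section Dual.
Context {R : realType} {X : normedModType R}.

Definition is_dual : {pred X -> R^o} :=
  fun f => `[< linear f /\ continuous f >].

Lemma is_dual_submod_closed : submod_closed is_dual.
Proof.
split=> [|a f g /asboolP[lf cf] /asboolP[lg cg]]; apply/asboolP; split.
- by move=> k u v; rewrite /= scaler0 addr0.
- exact: cst_continuous.
- move=> k u v; rewrite !fctE lf lg !scalerDr !scalerA [a * k]mulrC.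
  by rewrite addrACA.
- by move=> x; apply: cvgD; [apply: cvgZl_tmp; exact: cf|exact: cg].
Qed.

HB.instance Definition _ :=
  GRing.isSubmodClosed.Build R (X -> R^o) is_dual is_dual_submod_closed.

End Dual.

Record dual (R : realType) (X : normedModType R) := Dual {
  dual_fun :> X -> R^o;
  dual_funP : dual_fun \in is_dual }.

Section DualNorm.
Context {R : realType} {X : normedModType R}.

HB.instance Definition _ := [isSub for @dual_fun R X].
HB.instance Definition _ := [Choice of dual X by <:].
HB.instance Definition _ := [SubChoice_isSubLmodule of dual X by <:].

Implicit Types (f g : dual X).

Definition dual_norm f : R := sup [set `|f x| | x in [set x : X | `|x| <= 1]].

Lemma dual_subE f g x : (f - g) x = f x - g x. Proof. by []. Qed.

Lemma dual_linear f : linear f.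
Proof. by have /asboolP[] := dual_funP f. Qed.

Lemma dual_continuous f : continuous f.
Proof. by have /asboolP[] := dual_funP f. Qed.

Lemma dual0 f : f 0 = 0.
Proof.
have := dual_linear f 1 0 0; rewrite !scale1r addr0 => /eqP.
by rewrite -subr_eq0 opprD addrA subrr sub0r oppr_eq0 => /eqP.
Qed.

Lemma dualZ f (a : R) x : f (a *: x) = a * f x.
Proof. by have := dual_linear f a x 0; rewrite !addr0 dual0 addr0. Qed.

Lemma dual_norm_has_sup f :
  has_sup [set `|f x| | x in [set x : X | `|x| <= 1]].
Proof.
split; first by exists `|f 0|, 0 => //=; rewrite normr0 ler01.
pose F := GRing.isLinear.Build _ _ _ _ f (dual_linear f).
pose L : {linear X -> R^o} := HB.pack (dual_fun f) F.
have /linear_boundedP : bounded_near L (nbhs 0).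
  by apply: continuous_linear_bounded; exact: dual_continuous.
move=> [M [Mr HM]].
have M1 : M < `|M| + 1 by rewrite (le_lt_trans (ler_norm M))// ltrDl ltr01.
exists (`|M| + 1) => _ [x /= x1 <-].
apply: (le_trans (HM _ M1 x)).
by rewrite ler_piMr// addr_ge0.
Qed.

Lemma dual_norm_ub f x : `|x| <= 1 -> `|f x| <= dual_norm f.
Proof.
move=> x1; apply: sup_upper_bound; first exact: dual_norm_has_sup.
by exists x.
Qed.

Lemma dual_norm_le f (M : R) :
  (forall x, `|x| <= 1 -> `|f x| <= M) -> dual_norm f <= M.
Proof.
move=> fM; apply: ge_sup; first by case: (dual_norm_has_sup f).
by move=> _ [x /= x1 <-]; exact: fM.
Qed.

Lemma dual_normD f g : dual_norm (f + g) <= dual_norm f + dual_norm g.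
Proof.
apply: dual_norm_le => x x1.
by rewrite (le_trans (ler_normD _ _))// lerD// dual_norm_ub.
Qed.

Lemma dual_norm0_eq0 f : dual_norm f = 0 -> f = 0.
Proof.
move=> f0; apply/val_inj/funext => x /=.
have [->|x0] := eqVneq x 0; first exact: dual0.
have : `|f (`|x|^-1 *: x)| <= 0.
  by rewrite -f0 dual_norm_ub// normrZ normfV normr_id mulVf// normr_eq0.
by rewrite normr_le0 dualZ mulf_eq0 invr_eq0 normr_eq0 (negPf x0) => /eqP.
Qed.

Lemma dual_normMn f n : dual_norm (f *+ n) = dual_norm f *+ n.
Proof.
have E x : (f *+ n) x = f x *+ n.
  by elim: n => [//|n IH]; rewrite !mulrS -IH.
have [->|n0] := posnP n.
  rewrite !mulr0n; apply/eqP; rewrite eq_le; apply/andP; split.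
    by apply: dual_norm_le => x _; rewrite normr0.
  by apply: le_trans (@dual_norm_ub 0 0 _); rewrite // normr0.
apply/eqP; rewrite eq_le; apply/andP; split.
  by apply: dual_norm_le => x x1; rewrite E normrMn lerMn2r dual_norm_ub ?orbT.
rewrite -mulr_natr -ler_pdivlMr ?ltr0n//; apply: dual_norm_le => x x1.
by rewrite ler_pdivlMr ?ltr0n// mulr_natr -normrMn -E dual_norm_ub.
Qed.

Lemma dual_normN f : dual_norm (- f) = dual_norm f.
Proof.
by congr sup; apply: eq_imagel => x _; rewrite /= normrN.
Qed.

HB.instance Definition _ := Num.Zmodule_isNormed.Build R (dual X)
  dual_normD dual_norm0_eq0 dual_normMn dual_normN.

Lemma dual_normE f : `|f| = dual_norm f. Proof. by []. Qed.

End DualNorm.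

Section Multifunction.
Context {R : realType} {X : normedModType R}.
Implicit Types (T S : X -> set (dual X)) (x y : X) (xs ys : dual X).

Definition mgraph T : set (X * dual X) := [set p | T p.1 p.2].

Definition mdomain T : set X := [set x | T x !=set0].

Definition monotone_graph T := forall x xs y ys,
  mgraph T (x, xs) -> mgraph T (y, ys) -> 0 <= (xs - ys) (x - y).

Definition maximal_monotone T :=
  monotone_graph T /\ ~ exists S, monotone_graph S /\ mgraph T `<` mgraph S.

(* [ereal_sup set0 = -oo], so the value is 0 when the graph of [T] has no
   point over [X \ {x}]. *)
Definition mL x xs T : \bar R :=
  maxe 0%E (ereal_sup [set r | exists y ys,
    [/\ mgraph T (y, ys), y != x &
        r = ((xs - ys) (y - x) / `|x - y|)%:E]]).

(* [ereal_inf set0 = +oo], so the distance to the empty set is [+oo]. *)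
Definition dual_dist xs (A : set (dual X)) : \bar R :=
  ereal_inf [set `|ys - xs|%:E | ys in A].

Definition regular T :=
  maximal_monotone T /\ forall x xs, mL x xs T = dual_dist xs (T x).

Definition enlargement (e : R) T : X -> set (dual X) := fun x =>
  [set xs | forall y ys, mgraph T (y, ys) -> - e <= (xs - ys) (x - y)].

End Multifunction.

(* Main.v *)
(* If [x] has distance at least [r > 0] from the domain of [T], then every
   quotient in [L(x, x^*, T)] is at most [e / r] for [x^*] in [T_e(x)], so
   [L(x, x^*, T)] is finite. Regularity then makes [d(x^*, T(x))] finite, which
   forces [T(x)] to be nonempty. *)
Require Import Defs.
From mathcomp Require Import all_boot all_order all_algebra.
From mathcomp Require Import all_classical all_reals all_analysis.
Import Order.TTheory GRing.Theory Num.Theory.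
Import numFieldNormedType.Exports.
Local Open Scope classical_set_scope.
Local Open Scope ring_scope.

Lemma dualN (R : realType) (X : normedModType R) (f : dual X) (x : X) :
  f (- x) = - f x.
Proof. by rewrite -scaleN1r dualZ mulN1r. Qed.

Lemma dual_dist_set0 (R : realType) (X : normedModType R) (xs : dual X) :
  dual_dist xs set0 = +oo%E.
Proof. by rewrite /dual_dist image_set0 ereal_inf0. Qed.

(** Membership in the enlargement bounds each numerator by [e], and [farT] bounds each denominator
    below by [r]; being nonnegative, [e / r] also bounds the 0 in the maximum. *)
Lemma mL_enlargement_le (R : realType) (X : normedModType R)
    (T : X -> set (dual X)) (e r : R) (x : X) (xs : dual X) :
  0 <= e -> 0 < r -> (forall y, mdomain T y -> r <= `|x - y|) ->
  enlargement e T x xs -> (mL x xs T <= (e / r)%:E)%E.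
Proof.
move=> e0 r0 farT xsT; rewrite /mL ge_max; apply/andP; split.
  by rewrite lee_fin divr_ge0// ltW.
apply: ge_ereal_sup => _ [y [ys [Tys _ ->]]]; rewrite lee_fin.
have rxy : r <= `|x - y| by apply: farT; exists ys.
have xy0 : 0 < `|x - y| by exact: lt_le_trans rxy.
rewrite ler_pdivrMr//; apply: (@le_trans _ _ e).
  (* Reversing [y - x] turns the lower bound [- e] into the upper bound [e]. *)
  by rewrite -[y - x]opprB dualN lerNl; exact: xsT.
by rewrite mulrAC ler_pdivlMr// ler_wpM2l.
Qed.

Theorem theorem9 (R : realType) (X : completeNormedModType R)
    (T : X -> set (dual X)) (hT : regular T) (e : R) (he : 0 < e) :
  mdomain (enlargement e T) `<=` closure (mdomain T).
Proof.
move=> x [xs xsT]; have [_ /(_ x xs) regT] := hT.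
apply: contrapT => xNcl.
have Tx0 : T x = set0.
  apply/seteqP; split=> // ys Tys; apply: xNcl.
  by apply: subset_closure; exists ys.
have [r r0 farT] : exists2 r : R, 0 < r &
    forall y, mdomain T y -> r <= `|x - y|.
  (* If no such [r] existed, every ball around [x] would meet the domain, so [x] would lie in its
     closure. *)
  apply: contrapT => Nfar; apply: xNcl => B /nbhs_ballP[r /= r0 rB].
  apply: contrapT => NTB; apply: Nfar; exists r => // y Ty.
  rewrite leNgt; apply/negP => xyr; apply: NTB; exists y; split=> //.
  by apply: rB; rewrite -ball_normE.
(* By regularity this finite bound applies to the distance to the empty set [T x], which is [+oo]: a
   contradiction. *)
have := mL_enlargement_le _ _ _ _ _ _ _ (ltW he) r0 farT xsT.
by rewrite regT Tx0 dual_dist_set0.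
Qed.
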